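(* For every convergent $\mathbb{N}^*$-decorated rooted forest $F$ one has $$\zeta^T_{\mathrm{sh}}(\mathfrak{s}^T(F))\le\zeta^T_{\mathrm{st}}(F).$$ Furthermore, the inequality is an equality if and only if $F$ has no branching vertex (i.e. $F$ is empty or $F=l_1\cdots l_k$ with the $l_i$ ladder trees).
   Context: $\mathbb{N}^*=\mathbb{Z}_{\ge1}$. A rooted forest is a finite (possibly empty) disjoint union of finite (non-planar) rooted trees; an $\Omega$-decorated forest carries a map from its vertex set to $\Omega$; forests are taken up to isomorphism. $\mathcal{F}_\Omega$ is the commutative unital $\mathbb{R}$-algebra freely generated by nonempty $\Omega$-decorated rooted trees: product is concatenation (disjoint union), unit is the empty forest $\emptyset$, forests form a basis. $B_+^\omega(F)$ is the tree obtained from $F$ by adding a new root decorated by $\omega$ joined to every root of $F$ (extended linearly). A leaf is a vertex without direct successor (child); a branching vertex has strictly more than one direct successor; a ladder tree is a tree without branching vertex. An $\mathbb{N}^*$-decorated forest is convergent if it is empty or all its roots have decoration $\ge2$. Define $\mathcal{Z}_{-1}(F):\mathbb{N}^*\to\mathbb{R}$ by $\mathcal{Z}_{-1}(\emptyset)=1$, $\mathcal{Z}_{-1}(F_1F_2)=\mathcal{Z}_{-1}(F_1)\mathcal{Z}_{-1}(F_2)$, $\mathcal{Z}_{-1}(B_+^\alpha(F))(N)=\sum_{n=1}^{N-1}n^{-\alpha}\mathcal{Z}_{-1}(F)(n)$ (empty sum $=0$). For convergent $F$, $\zeta^T_{\mathrm{st}}(F)=\lim_{N\to\infty}\mathcal{Z}_{-1}(F)(N)$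 (the limit exists). A forest in $\mathcal{F}_{\{x,y\}}$ is convergent if all its leaves and branching vertices are decorated by $y$ and all its roots by $x$ (the empty forest is convergent). With $\sigma_x(t)=1/t$, $\sigma_y(t)=1/(1-t)$ and $0<\epsilon<1$ define on $[\epsilon,1[$: $A_\epsilon(\emptyset)=1$, $A_\epsilon(F_1F_2)=A_\epsilon(F_1)A_\epsilon(F_2)$, $A_\epsilon(B_+^\omega(F))(z)=\int_\epsilon^z\sigma_\omega(t)A_\epsilon(F)(t)dt$. For convergent $F$, $\zeta^T_{\mathrm{sh}}(F)=\lim_{z\to1^-}\lim_{\epsilon\to0^+}A_\epsilon(F)(z)$ (the limits exist). The branched binarisation map $\mathfrak{s}^T:\mathcal{F}_{\mathbb{N}^*}\to\mathcal{F}_{\{x,y\}}$ is the unique unital algebra morphism (for concatenation) such that $\mathfrak{s}^T(B_+^n(F))=(B_+^x)^{n-1}\big(B_+^y(\mathfrak{s}^T(F))\big)$ for all $n\ge1$ and all forests $F$. It maps convergent forests to convergent forests. *)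

(* Defs.v *)
From HB Require Import structures.
From mathcomp Require Import all_boot all_order all_algebra.
From mathcomp Require Import generic_quotient.
From mathcomp Require Import all_classical all_reals all_analysis.

Set Implicit Arguments.
Unset Strict Implicit.
Unset Printing Implicit Defensive.

Import Order.TTheory GRing.Theory Num.Theory.
Import numFieldNormedType.Exports.

Local Open Scope quotient_scope.
Local Open Scope classical_set_scope.
Local Open Scope ring_scope.

(* Planar decorated rooted trees; a sequence of trees is a planar forest.
   Non-planar forests are obtained below by quotienting. *)
Inductive tree (Omega : Type) : Type := Node of Omega & seq (tree Omega).

HB.instance Definition _ (Omega : Type) := gen_eqMixin (tree Omega).
HB.instance Definition _ (Omega : Type) := gen_choiceMixin (tree Omega).

Section Trees.
Variable Omega : Type.

Definition decor (t : tree Omega) := let: Node a _ := t in a.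

Definition children (t : tree Omega) := let: Node _ s := t in s.

Fixpoint fold_tree (V : Type) (node : Omega -> seq V -> V) (t : tree Omega) : V :=
  let: Node a s := t in node a (map (fold_tree node) s).

(* A vertex of a tree is identified with the subtree it spans: its decoration
   is the root decoration and its direct successors are the roots of the
   children. *)
Fixpoint vertices (t : tree Omega) : seq (tree Omega) :=
  t :: flatten (map vertices (children t)).

Definition is_leaf (v : tree Omega) : bool := size (children v) == 0%N.

Definition is_branching (v : tree Omega) : bool := (1 < size (children v))%N.

Lemma planar_ind (P : seq (tree Omega) -> Prop) :
  P [::] -> (forall a s t, P s -> P t -> P (Node a s :: t)) -> forall s, P s.
Proof.
move=> P0 P1.
have P2 : forall u t, P (children u) -> P t -> P (u :: t).
  by move=> [a s] t; exact: P1.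
have Pt : forall u, P (children u).
  by fix IH 1 => -[a s] /=; elim: s => [//|u s IHs]; exact: (P2 u s (IH u) IHs).
by elim=> [//|u t IHt]; exact: P2.
Qed.

(* Isomorphism of decorated rooted forests: equality up to reordering the
   trees of the forest and, recursively, the children of every vertex. *)
Inductive fiso : seq (tree Omega) -> seq (tree Omega) -> Prop :=
| fiso_nil : fiso [::] [::]
| fiso_cons a s s' t t' :
    fiso s s' -> fiso t t' -> fiso (Node a s :: t) (Node a s' :: t')
| fiso_swap t1 t2 s : fiso (t1 :: t2 :: s) (t2 :: t1 :: s)
| fiso_trans s1 s2 s3 : fiso s1 s2 -> fiso s2 s3 -> fiso s1 s3.

Lemma fiso_refl s : fiso s s.
Proof. by elim/planar_ind: s => [|a s t]; constructor. Qed.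

Lemma fiso_sym s t : fiso s t -> fiso t s.
Proof.
elim=> [|a s1 s2 t1 t2 _ ? _ ?|t1 t2 s1|s1 s2 s3 _ IH1 _ IH2]; try by constructor.
exact: fiso_trans IH2 IH1.
Qed.

Let fiso_rel (s t : seq (tree Omega)) : bool := `[< fiso s t >].

Let fiso_rel_refl : reflexive fiso_rel.
Proof. by move=> s; apply/asboolP/fiso_refl. Qed.

Let fiso_rel_sym : symmetric fiso_rel.
Proof. by move=> s t; apply/asboolP/asboolP => /fiso_sym. Qed.

Let fiso_rel_trans : transitive fiso_rel.
Proof.
by move=> s2 s1 s3 /asboolP h1 /asboolP h2; apply/asboolP/(fiso_trans h1 h2).
Qed.

Canonical fiso_equiv := EquivRel fiso_rel fiso_rel_refl fiso_rel_sym fiso_rel_trans.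

End Trees.

Definition forest (Omega : Type) := {eq_quot (fiso_equiv Omega)}.

HB.instance Definition _ (Omega : Type) := Choice.on (forest Omega).
HB.instance Definition _ (Omega : Type) :=
  EqQuotient.on (forest Omega).

Section Forests.
Variable Omega : Type.
Implicit Types F G : forest Omega.

Definition fempty : forest Omega := \pi_(forest Omega) [::].

Definition fcat F G : forest Omega := \pi_(forest Omega) (repr F ++ repr G).

Definition Bplus (a : Omega) F : forest Omega :=
  \pi_(forest Omega) [:: Node a (repr F)].

(* The functions below are defined on a representative; they do not depend on
   its choice, see [fiso_repr_pi] and the invariance lemmas. *)
Definition fvertices F : seq (tree Omega) :=
  flatten [seq vertices t | t <- repr F].

Definition no_branching F : bool := ~~ has (@is_branching Omega) (fvertices F).

Lemma pi_fiso (s t : seq (tree Omega)) :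
  (\pi_(forest Omega) s = \pi_(forest Omega) t) <-> fiso s t.
Proof. by split=> [/eqmodP/asboolP|h]; [|apply/eqmodP/asboolP]. Qed.

Lemma fiso_repr_pi (s : seq (tree Omega)) : fiso (repr (\pi_(forest Omega) s)) s.
Proof. by apply/pi_fiso; rewrite reprK. Qed.

Lemma fiso_cat (s s' t t' : seq (tree Omega)) :
  fiso s s' -> fiso t t' -> fiso (s ++ t) (s' ++ t').
Proof.
move=> hs ht; have hr : forall u, fiso (u ++ t) (u ++ t').
  by elim/planar_ind => [//|a u v _ IH] /=; apply: fiso_cons => //; exact: fiso_refl.
apply: fiso_trans (hr s) _ => {hr ht t}.
elim: hs => [|a u u' v v' hu _ _ IH|t1 t2 u|u1 u2 u3 _ IH1 _ IH2] /=.
- exact: fiso_refl.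
- exact: fiso_cons.
- exact: fiso_swap.
- exact: fiso_trans IH1 IH2.
Qed.

Lemma fcat_pi (s t : seq (tree Omega)) :
  fcat (\pi_(forest Omega) s) (\pi_(forest Omega) t) = \pi_(forest Omega) (s ++ t).
Proof. by apply/pi_fiso; apply: fiso_cat; exact: fiso_repr_pi. Qed.

Lemma Bplus_pi a (s : seq (tree Omega)) :
  Bplus a (\pi_(forest Omega) s) = \pi_(forest Omega) [:: Node a s].
Proof.
by apply/pi_fiso; apply: fiso_cons; [exact: fiso_repr_pi|exact: fiso_nil].
Qed.

Lemma forest_ind (P : forest Omega -> Prop) :
  P fempty -> (forall a F G, P F -> P G -> P (fcat (Bplus a F) G)) ->
  forall F, P F.
Proof.
move=> P0 P1 F; rewrite -[F]reprK.
elim/planar_ind: (repr F) => [//|a s t Ps Pt].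
by have := P1 a _ _ Ps Pt; rewrite Bplus_pi fcat_pi.
Qed.

Lemma all_roots_fiso (p : pred Omega) (s t : seq (tree Omega)) :
  fiso s t -> all (fun u => p (decor u)) s = all (fun u => p (decor u)) t.
Proof.
elim=> [//|a u u' v v' _ _ _ /= -> //|t1 t2 u /=|u1 u2 u3 _ -> _ -> //].
by rewrite andbCA.
Qed.

Lemma size_fiso (s t : seq (tree Omega)) : fiso s t -> size s = size t.
Proof. by elim=> //= [a u u' v v' _ _ _ ->|u1 u2 u3 _ -> _ ->]. Qed.

(* Any property of a vertex depending only on its decoration and on its number
   of direct successors can be tested on an arbitrary representative. *)
Lemma all_vertices_fiso (p : Omega -> nat -> bool) (s t : seq (tree Omega)) :
  let q v := p (decor v) (size (children v)) in
  fiso s t -> all q (flatten (map (@vertices Omega) s)) =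
              all q (flatten (map (@vertices Omega) t)).
Proof.
move=> q; elim=> [//|a u u' v v' hu IHu _ IHv|t1 t2 u|u1 u2 u3 _ -> _ -> //] /=.
  by rewrite !all_cat IHu IHv /q /= (size_fiso hu).
by rewrite !all_cat andbCA.
Qed.

End Forests.

Section Stuffle.
Variable R : realType.

Definition Npos := {n : nat | (0 < n)%N}.

Definition st_convergent (F : forest Npos) : bool :=
  all (fun t => (2 <= val (decor t))%N) (repr F).

Definition Zst_tree : tree Npos -> nat -> R :=
  fold_tree (fun (alpha : Npos) (fs : seq (nat -> R)) (N : nat) =>
    \sum_(1 <= n < N) n%:R ^- val alpha * \prod_(f <- fs) f n).

Definition Zst (F : forest Npos) (N : nat) : R :=
  \prod_(t <- repr F) Zst_tree t N.

Definition zeta_st (F : forest Npos) : R := lim (Zst F N @[N --> \oo]).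

Lemma Zst_fiso (s t : seq (tree Npos)) N : fiso s t ->
  \prod_(u <- s) Zst_tree u N = \prod_(u <- t) Zst_tree u N.
Proof.
move=> h; elim: h N => [//|a u u' v v' _ IHu _ IHv|t1 t2 u|u1 u2 u3 _ IH1 _ IH2] N.
- rewrite !big_cons IHv /=; congr (_ * _).
  by apply: eq_bigr => n _; rewrite !big_map IHu.
- by rewrite !big_cons mulrCA.
- by rewrite IH1 IH2.
Qed.

Lemma Zst_empty N : Zst (fempty Npos) N = 1.
Proof. by rewrite /Zst (Zst_fiso _ (fiso_repr_pi _)) big_nil. Qed.

Lemma Zst_cat F G N : Zst (fcat F G) N = Zst F N * Zst G N.
Proof. by rewrite /Zst (Zst_fiso _ (fiso_repr_pi _)) big_cat. Qed.

Lemma Zst_Bplus alpha F N :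
  Zst (Bplus alpha F) N = \sum_(1 <= n < N) n%:R ^- val alpha * Zst F n.
Proof.
rewrite /Zst (Zst_fiso _ (fiso_repr_pi _)) big_seq1 /=.
by apply: eq_bigr => n _; rewrite big_map.
Qed.

End Stuffle.

Inductive letter : Type := Lx | Ly.

Definition is_x (l : letter) : bool := if l is Lx then true else false.
Definition is_y (l : letter) : bool := if l is Ly then true else false.

Section Shuffle.
Variable R : realType.

Definition sh_convergent (F : forest letter) : bool :=
  all (fun v => (is_leaf v || is_branching v) ==> is_y (decor v)) (fvertices F)
  && all (fun t => is_x (decor t)) (repr F).

Definition sigma (l : letter) (t : R) : R :=
  match l with Lx => t^-1 | Ly => (1 - t)^-1 end.

Definition Ash_tree (eps : R) : tree letter -> R -> R :=
  fold_tree (fun (l : letter) (fs : seq (R -> R)) (z : R) =>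
    \int[lebesgue_measure]_(t in `[eps, z]) (sigma l t * \prod_(f <- fs) f t)).

Definition Ash (eps : R) (F : forest letter) (z : R) : R :=
  \prod_(t <- repr F) Ash_tree eps t z.

Definition zeta_sh (F : forest letter) : R :=
  lim ((lim (Ash eps F z @[eps --> 0^'+])) @[z --> 1^'-]).

Lemma Ash_fiso eps (s t : seq (tree letter)) z : fiso s t ->
  \prod_(u <- s) Ash_tree eps u z = \prod_(u <- t) Ash_tree eps u z.
Proof.
move=> h; elim: h z => [//|a u u' v v' _ IHu _ IHv|t1 t2 u|u1 u2 u3 _ IH1 _ IH2] z.
- rewrite !big_cons IHv /=; congr (_ * _).
  by apply: eq_Rintegral => x _; rewrite !big_map IHu.
- by rewrite !big_cons mulrCA.
- by rewrite IH1 IH2.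
Qed.

Lemma Ash_empty eps z : Ash eps (fempty letter) z = 1.
Proof. by rewrite /Ash (Ash_fiso _ _ (fiso_repr_pi _)) big_nil. Qed.

Lemma Ash_cat eps F G z : Ash eps (fcat F G) z = Ash eps F z * Ash eps G z.
Proof. by rewrite /Ash (Ash_fiso _ _ (fiso_repr_pi _)) big_cat. Qed.

Lemma Ash_Bplus eps l F z : Ash eps (Bplus l F) z =
  \int[lebesgue_measure]_(t in `[eps, z]) (sigma l t * Ash eps F t).
Proof.
rewrite /Ash (Ash_fiso _ _ (fiso_repr_pi _)) big_seq1 /=.
by apply: eq_Rintegral => t _; rewrite big_map.
Qed.

End Shuffle.

Definition bin_tree : tree Npos -> tree letter :=
  fold_tree (fun (n : Npos) (ss : seq (tree letter)) =>
    iter (val n).-1 (fun t => Node Lx [:: t]) (Node Ly ss)).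

(* The restriction to forests of the branched binarisation morphism; being
   multiplicative, it maps the basis of forests to itself.  It is characterised
   by [sT_empty], [sT_cat] and [sT_Bplus], see [sT_unique]. *)
Definition sT (F : forest Npos) : forest letter :=
  \pi_(forest letter) (map bin_tree (repr F)).

Lemma bin_treeE n s : bin_tree (Node n s) =
  iter (val n).-1 (fun t => Node Lx [:: t]) (Node Ly (map bin_tree s)).
Proof. by []. Qed.

Lemma bin_fiso (s t : seq (tree Npos)) :
  fiso s t -> fiso (map bin_tree s) (map bin_tree t).
Proof.
elim=> [|a u u' v v' _ IHu _ IHv|t1 t2 u|u1 u2 u3 _ IH1 _ IH2] /=.
- exact: fiso_nil.
- suff : fiso [:: bin_tree (Node a u)] [:: bin_tree (Node a u')].
    by move=> h; exact: (fiso_cat h IHv).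
  rewrite !bin_treeE; elim: (val a).-1 => [|n IHn]; rewrite ?iterS;
    by apply: fiso_cons => //; exact: fiso_nil.
- exact: fiso_swap.
- exact: fiso_trans IH1 IH2.
Qed.

Lemma sT_pi (s : seq (tree Npos)) :
  sT (\pi_(forest Npos) s) = \pi_(forest letter) (map bin_tree s).
Proof. by apply/pi_fiso; apply: bin_fiso; exact: fiso_repr_pi. Qed.

Lemma sT_empty : sT (fempty Npos) = fempty letter.
Proof. exact: sT_pi. Qed.

Lemma sT_cat F G : sT (fcat F G) = fcat (sT F) (sT G).
Proof. by rewrite /fcat sT_pi map_cat -fcat_pi. Qed.

Lemma sT_Bplus n F :
  sT (Bplus n F) = iter (val n).-1 (Bplus Lx) (Bplus Ly (sT F)).
Proof.
rewrite sT_pi /sT Bplus_pi [map _ _]/= -/(bin_tree _) bin_treeE.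
by elim: (val n).-1 => [//|k IHk]; rewrite [in RHS]iterS -IHk Bplus_pi.
Qed.

Lemma sT_convergent F : st_convergent F -> sh_convergent (sT F).
Proof.
pose q v := (is_leaf v || is_branching v) ==> is_y (decor v).
have hall s : all q (flatten (map (@vertices letter) (map bin_tree s))).
  elim/planar_ind: s => [//|a s t IHs IHt] /=; rewrite all_cat IHt andbT.
  rewrite bin_treeE; elim: (val a).-1 => [|n IHn] /=.
    by rewrite IHs andbT /q /= implybT.
  by rewrite cats0 IHn.
rewrite /st_convergent /sh_convergent /fvertices => hF; apply/andP; split.
  pose p (l : letter) (n : nat) := ((n == 0%N) || (1 < n)%N) ==> is_y l.
  have -> := all_vertices_fiso p (fiso_repr_pi (map bin_tree (repr F))).
  exact: hall.
rewrite (all_roots_fiso is_x (fiso_repr_pi (map bin_tree (repr F)))) all_map.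
by apply: sub_all hF => -[[[|[|n]] hn] s].
Qed.

Lemma sT_unique (s : forest Npos -> forest letter) :
  s (fempty Npos) = fempty letter ->
  (forall F G, s (fcat F G) = fcat (s F) (s G)) ->
  (forall n F, s (Bplus n F) = iter (val n).-1 (Bplus Lx) (Bplus Ly (s F))) ->
  forall F, s F = sT F.
Proof.
move=> s0 s1 s2; apply: forest_ind => [|a F G hF hG]; first by rewrite s0 sT_empty.
by rewrite s1 s2 hF hG sT_cat sT_Bplus.
Qed.

(* Main.v *)
Require Import Defs.
From mathcomp Require Import all_boot all_order all_algebra.
From mathcomp Require Import all_classical all_reals all_analysis.
From mathcomp Require Import ring lra.

(** Both zeta values are sums of the same nature: attach to every forest [s] a
nonnegative sequence [forest_coef s], the coefficients of the power series that
the iterated integrals of the binarised forest converge to.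

Integrating against dt/(1-t) turns a power series with coefficients g_m into
one with coefficients (g_0 + ... + g_(k-1)) / k, and each integration against
dt/t divides the k-th coefficient by k once more.  The tree with root decorated
by n over the forest s therefore has coefficients
   k^-n (g_0 + ... + g_(k-1)),   where g = forest_coef s,
and its partial sums P satisfy the recurrence of the nested sums Z:
   P(tree)(N) = sum_(1 <= k < N) k^-n P(s)(k),
   Z(tree)(N) = sum_(1 <= k < N) k^-n Z(s)(k).
The two differ on products only.  Multiplication of functions is the Cauchy
product of coefficients, whose N-th partial sum runs over the triangle
i + j < N, while the product of partial sums runs over the square i, j < N.
With nonnegative terms this gives P <= Z ([series_forest_coef_le]), and the
inequality is strict for large N as soon as a product of two nonempty forests
occurs, because coefficients of trees are eventually positive
([series_forest_coef_lt]).  Below a root such a gap never closes, since the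
difference of the two sums over k is a sum of nonnegative terms
([tree_gap_nondecreasing]); hence a tree has equal zeta values exactly when
none of its vertices branches ([tree_sh_leif]).  At the top level both zeta
values are multiplicative, the triangle and the square having the same limit
([cvg_series_cauchy]), so concatenation of trees does not create any gap.

Three limits have to be justified.  Nested sums of a convergent tree are bounded
since Z(s)(N) is at most a power of the harmonic sum
([harmonic_pow_sum_bounded]).  The regularised integrals tend to the power
series when the lower bound of integration tends to 0: they are below it, and
above c times it, for every c < 1, uniformly away from 0 ([approximates],
[approximates_integral]).  Finally the power series tends to the sum of its
coefficients at 1 ([abel_cvg]). *)

Set Implicit Arguments.
Unset Strict Implicit.
Unset Printing Implicit Defensive.

Import Order.TTheory GRing.Theory Num.Theory.
Import numFieldNormedType.Exports.

Local Open Scope classical_set_scope.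
Local Open Scope ring_scope.

(** * Coefficients of the generating functions *)

Section CauchyProduct.
Variable R : realType.
Implicit Types (a b g : nat -> R).

Definition cauchy a b (n : nat) : R := \sum_(0 <= i < n.+1) a i * b (n - i)%N.

Definition unit_coef (n : nat) : R := (n == 0%N)%:R.

(** Effect on coefficients of one integration against dt/(1-t) followed by
    d - 1 integrations against dt/t; it is also the summand of a nested sum with
    exponent d. *)
Definition node_coef (d : nat) g (k : nat) : R := k%:R ^- d * series g k.

Lemma series_ge0 a N : (forall n, 0 <= a n) -> 0 <= series a N.
Proof. by move=> a0; rewrite /series /= sumr_ge0. Qed.

Lemma series_le a M N : (forall n, 0 <= a n) -> (M <= N)%N ->
  series a M <= series a N.
Proof. by move=> a0; exact: nondecreasing_series. Qed.

Lemma series_gt0 a j N : (forall n, 0 <= a n) -> 0 < a j -> (j < N)%N ->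
  0 < series a N.
Proof.
move=> a0 aj jN; apply: lt_le_trans (series_le a0 jN).
by rewrite seriesSr ltr_wpDl ?series_ge0.
Qed.

Lemma series_unit_coef N : series unit_coef N = (0 < N)%:R.
Proof.
case: N => [|N]; first by rewrite /series /= big_geq.
rewrite /series /= big_nat_recl // big1 ?addr0 // => i _.
Qed.

(** The triangle i + j < N, sliced along i. *)
Lemma series_cauchy a b N :
  series (cauchy a b) N = \sum_(0 <= i < N) a i * series b (N - i)%N.
Proof.
elim: N => [|N IHN]; first by rewrite /series /= !big_geq.
rewrite seriesSr IHN [in RHS]big_nat_recr //= subSnn seriesSr.
rewrite /series /= [X in _ * (X + _)]big_geq // add0r /cauchy.
rewrite [X in _ + X]big_nat_recr //= subnn addrA -big_split /=; congr (_ + _).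
apply: eq_big_nat => i /andP[_ iN]; rewrite -mulrDr subSn; last exact: ltnW.
by rewrite big_nat_recr.
Qed.

Lemma cauchy_ge0 a b n : (forall i, 0 <= a i) -> (forall i, 0 <= b i) ->
  0 <= cauchy a b n.
Proof. by move=> a0 b0; apply: sumr_ge0 => i _; rewrite mulr_ge0. Qed.

Lemma cauchy_gt0 a b i j : (forall i, 0 <= a i) -> (forall i, 0 <= b i) ->
  0 < a i -> 0 < b j -> 0 < cauchy a b (i + j).
Proof.
move=> a0 b0 ai bj; rewrite /cauchy big_mkord.
have iij : (i < (i + j).+1)%N by rewrite ltnS leq_addr.
rewrite (bigD1 (Ordinal iij)) //= addKn ltr_wpDr ?mulr_gt0 //.
by apply: sumr_ge0 => k _; rewrite mulr_ge0.
Qed.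

Lemma cauchy_unit_coef a : cauchy a unit_coef = a.
Proof.
apply/funext => n; rewrite /cauchy big_nat_recr //= subnn /unit_coef eqxx mulr1.
rewrite big_nat_cond big1 ?add0r // => i /andP[/andP[_ iN] _].
by rewrite subn_eq0 leqNgt iN mulr0.
Qed.

Lemma series_cauchy_le a b N : (forall i, 0 <= a i) -> (forall i, 0 <= b i) ->
  series (cauchy a b) N <= series a N * series b N.
Proof.
move=> a0 b0; rewrite series_cauchy {2}/series /= mulr_suml.
by apply: ler_sum => i _; rewrite ler_wpM2l // series_le // leq_subr.
Qed.

(** The slice i = M of the triangle i + j <= M stops at j = 0, whereas in the
    square it reaches a later positive term of [b]. *)
Lemma series_cauchy_lt a b j M : (forall i, 0 <= a i) -> (forall i, 0 <= b i) ->
  0 < a M -> 0 < b j -> (0 < j <= M)%N ->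
  series (cauchy a b) M.+1 < series a M.+1 * series b M.+1.
Proof.
move=> a0 b0 aM bj /andP[j0 jM].
rewrite series_cauchy seriesSr mulrDl big_nat_recr //=.
apply: ler_ltD.
  rewrite {2}/series /= mulr_suml.
  by apply: ler_sum => i _; rewrite ler_wpM2l // series_le // leq_subr.
rewrite ltr_pM2l // subSnn; apply: le_lt_trans (series_le b0 j0) _.
by apply: lt_le_trans (series_le b0 (_ : j.+1 <= _)%N) => //; rewrite seriesSr ltrDl.
Qed.

(** The square of side N is contained in the triangle of side 2N. *)
Lemma series_cauchy_ge a b N : (forall i, 0 <= a i) -> (forall i, 0 <= b i) ->
  series a N * series b N <= series (cauchy a b) (N + N).
Proof.
move=> a0 b0; rewrite series_cauchy /series /= mulr_suml.
rewrite (@big_cat_nat _ _ _ N 0%N (N + N)%N) ?leq_addl //=.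
apply: ler_wpDr.
  by apply: sumr_ge0 => i _; rewrite mulr_ge0 // (series_ge0 _ b0).
apply: ler_sum_nat => i /andP[_ iN]; rewrite ler_wpM2l //.
by apply: (series_le b0); rewrite -addnBA ?leq_addr // ltnW.
Qed.

(** Triangles are squeezed between two squares. *)
Lemma cvg_series_cauchy a b (la lb : R) :
  (forall i, 0 <= a i) -> (forall i, 0 <= b i) ->
  series a @ \oo --> la -> series b @ \oo --> lb ->
  series (cauchy a b) @ \oo --> la * lb.
Proof.
move=> a0 b0 ca cb.
have cab : (series a \* series b) @ \oo --> la * lb by exact: cvgM.
have ndc : nondecreasing_seq (series (cauchy a b)).
  by apply: nondecreasing_series => n _ _; exact: cauchy_ge0.
have ub N : series (cauchy a b) N <= la * lb.
  apply: le_trans (series_cauchy_le N a0 b0) _.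
  rewrite -(cvg_lim _ cab) //; apply: (@nondecreasing_cvgn_le _ (series a \* series b)).
    by move=> m n mn /=; rewrite ler_pM ?series_ge0 ?series_le.
  by apply/cvg_ex; exists (la * lb).
have cc : cvgn (series (cauchy a b)).
  by apply: nondecreasing_is_cvgn => //; exists (la * lb) => _ [n _ <-].
suff -> : la * lb = limn (series (cauchy a b)) by [].
apply/eqP; rewrite eq_le; apply/andP; split; last first.
  by apply: limr_le => //; exact: nearW.
rewrite -(cvg_lim _ cab) //; apply: limr_le; first by apply/cvg_ex; exists (la * lb).
apply: nearW => n /=; apply: le_trans (series_cauchy_ge n a0 b0) _.
exact: nondecreasing_cvgn_le.
Qed.

Lemma node_coef_ge0 d g k : (forall i, 0 <= g i) -> 0 <= node_coef d g k.
Proof. by move=> g0; rewrite mulr_ge0 ?series_ge0 // invr_ge0 exprn_ge0. Qed.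

Lemma series_node_coef d g N :
  series (node_coef d g) N = \sum_(1 <= k < N) k%:R ^- d * series g k.
Proof.
case: N => [|N]; first by rewrite /series /= !big_geq.
rewrite {1}/series /= big_ltn // {1}/node_coef /series /= [X in _ * X]big_geq //.
by rewrite mulr0 add0r.
Qed.

End CauchyProduct.

Section Coefficients.
Variable R : realType.
Implicit Types (u : tree Npos) (s : seq (tree Npos)).

(** Kept apart from [forest_coef] because [fold_tree] hands over the coefficient
    sequences of the children, not the children. *)
Definition forest_coef_of (cs : seq (nat -> R)) : nat -> R :=
  foldr (@cauchy R) (@unit_coef R) cs.

Definition tree_coef : tree Npos -> nat -> R :=
  fold_tree (fun d cs => node_coef (val d) (forest_coef_of cs)).

Definition forest_coef s : nat -> R := forest_coef_of (map tree_coef s).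

Definition stuffle_sum s (N : nat) : R := \prod_(u <- s) Zst_tree R u N.

Lemma tree_coefE d s : tree_coef (Node d s) = node_coef (val d) (forest_coef s).
Proof. by []. Qed.

Lemma forest_coef_cons u s :
  forest_coef (u :: s) = cauchy (tree_coef u) (forest_coef s).
Proof. by []. Qed.

Lemma forest_coef1 u : forest_coef [:: u] = tree_coef u.
Proof. by rewrite forest_coef_cons cauchy_unit_coef. Qed.

Lemma stuffle_sum_nil N : stuffle_sum [::] N = 1.
Proof. by rewrite /stuffle_sum big_nil. Qed.

Lemma stuffle_sum_cons u s N : stuffle_sum (u :: s) N = Zst_tree R u N * stuffle_sum s N.
Proof. by rewrite /stuffle_sum big_cons. Qed.

Lemma Zst_treeE d s N :
  Zst_tree R (Node d s) N = \sum_(1 <= n < N) n%:R ^- val d * stuffle_sum s n.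
Proof. by apply: eq_bigr => n _; rewrite big_map. Qed.

Lemma forest_coef_ge0 s k : 0 <= forest_coef s k.
Proof.
elim/planar_ind: s k => [|d s t IHs IHt] k; first exact: ler0n.
rewrite forest_coef_cons tree_coefE; apply: cauchy_ge0 => // i.
exact: node_coef_ge0.
Qed.

Lemma tree_coef_ge0 u k : 0 <= tree_coef u k.
Proof. by rewrite -forest_coef1 forest_coef_ge0. Qed.

Lemma forest_coef_neq0 s : exists k, 0 < forest_coef s k.
Proof.
elim/planar_ind: s => [|d s t [k sk] [l tl]]; first by exists 0%N; exact: ltr01.
exists (k.+1 + l)%N; rewrite forest_coef_cons.
apply: cauchy_gt0 => //; [exact: tree_coef_ge0|exact: forest_coef_ge0|].
rewrite tree_coefE mulr_gt0 ?invr_gt0 ?exprn_gt0 //.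
by apply: series_gt0 sk _ => // i; exact: forest_coef_ge0.
Qed.

(** Every coefficient of a tree carries a whole partial sum of the forest below
    its root, so that one positive coefficient there makes all the later ones
    positive. *)
Lemma tree_coef_gt0 u : \forall k \near \oo, 0 < tree_coef u k.
Proof.
case: u => d s; have [j sj] := forest_coef_neq0 s.
exists j.+1 => // k /= jk; rewrite tree_coefE mulr_gt0 ?invr_gt0 ?exprn_gt0 ?ltr0n //.
  by apply: leq_trans jk.
by apply: series_gt0 sj _ => // i; exact: forest_coef_ge0.
Qed.

Lemma forest_coef_gt0 s : s != [::] -> exists2 k, (0 < k)%N & 0 < forest_coef s k.
Proof.
case: s => [//|u s] _; have [j sj] := forest_coef_neq0 s.
have [K _ uK] := tree_coef_gt0 u.
exists (K.+1 + j)%N => //; rewrite forest_coef_cons cauchy_gt0 //.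
- by move=> i; exact: tree_coef_ge0.
- by move=> i; exact: forest_coef_ge0.
by apply: uK => /=.
Qed.

Lemma series_tree_coef d s N :
  series (tree_coef (Node d s)) N = \sum_(1 <= k < N) k%:R ^- val d * series (forest_coef s) k.
Proof. by rewrite tree_coefE series_node_coef. Qed.

(** Both sides obey the same recurrence at a root; on a product the triangle is
    compared with the square. *)
Lemma series_forest_coef_le s N : series (forest_coef s) N <= stuffle_sum s N.
Proof.
elim/planar_ind: s N => [|d s t IHs IHt] N.
  by rewrite stuffle_sum_nil series_unit_coef lern1 leq_b1.
have u0 := tree_coef_ge0 (Node d s); have t0 := forest_coef_ge0 t.
rewrite forest_coef_cons stuffle_sum_cons.
apply: le_trans (series_cauchy_le N u0 t0) _.
rewrite ler_pM ?series_ge0 // series_tree_coef Zst_treeE.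
by apply: ler_sum => k _; rewrite ler_wpM2l // invr_ge0 exprn_ge0.
Qed.

Lemma series_tree_coef_le u N : series (tree_coef u) N <= Zst_tree R u N.
Proof.
by have := series_forest_coef_le [:: u] N; rewrite forest_coef1 /stuffle_sum big_seq1.
Qed.

Lemma stuffle_sum_ge0 s N : 0 <= stuffle_sum s N.
Proof.
apply: le_trans (series_forest_coef_le s N); apply: series_ge0 => k.
exact: forest_coef_ge0.
Qed.

Lemma Zst_tree_ge0 u N : 0 <= Zst_tree R u N.
Proof. by have := stuffle_sum_ge0 [:: u] N; rewrite /stuffle_sum big_seq1. Qed.

Definition branched s := has (@is_branching Npos) (flatten (map (@vertices Npos) s)).

(** The hypothesis holds for the children of a vertex exactly when this vertex or
    one of its descendants branches, which is what the induction needs: for a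
    single tree the gap is inherited from the forest below the root, otherwise
    it comes from the product. *)
Lemma series_forest_coef_lt s : (1 < size s)%N || branched s ->
  \forall N \near \oo, series (forest_coef s) N < stuffle_sum s N.
Proof.
elim/planar_ind: s => [//|d s t IHs _].
case: (eqVneq t [::]) => [->|tn0 _].
  rewrite /branched /= cats0 => /IHs[K _ sK].
  (* The gap of the forest below the root at K + 1 is one of the terms summed. *)
  exists K.+2 => // N /= KN.
  rewrite forest_coef1 /stuffle_sum big_seq1 series_tree_coef Zst_treeE.
  have KinN : K.+1 \in index_iota 1 N by rewrite mem_index_iota.
  rewrite !(bigD1_seq K.+1 KinN) ?iota_uniq //=.
  apply: ltr_leD.
    by rewrite ltr_pM2l ?invr_gt0 ?exprn_gt0 //; apply: sK => /=.
  by apply: ler_sum => k _; rewrite ler_wpM2l ?series_forest_coef_le // invr_ge0 exprn_ge0.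
have [j j0 tj] := forest_coef_gt0 tn0.
have [K _ uK] := tree_coef_gt0 (Node d s).
exists (K + j).+1 => // -[//|N] /= KN; rewrite ltnS in KN.
rewrite forest_coef_cons stuffle_sum_cons.
have u0 := tree_coef_ge0 (Node d s); have t0 := forest_coef_ge0 t.
apply: (@lt_le_trans _ _ (series (tree_coef (Node d s)) N.+1 * series (forest_coef t) N.+1)).
  apply: (series_cauchy_lt u0 t0 _ tj); first by apply: uK; apply: leq_trans KN; rewrite leq_addr.
  by rewrite j0 (leq_trans _ KN) // leq_addl.
by rewrite ler_pM ?series_ge0 ?series_tree_coef_le ?series_forest_coef_le.
Qed.

(** For at most one tree no product occurs.  At N = 0 the empty forest has
    partial sum 0 and nested sum 1, whence the lower bound on N. *)
Lemma series_forest_coef_eq s N : (size s <= 1)%N -> ~~ branched s -> (0 < N)%N ->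
  series (forest_coef s) N = stuffle_sum s N.
Proof.
elim/planar_ind: s N => [|d s t IHs _] N; first by rewrite stuffle_sum_nil series_unit_coef => _ _ ->.
case: t => [|//] _; rewrite /branched /= cats0 negb_or /is_branching /= -leqNgt => /andP[s1 nbs] _.
rewrite forest_coef1 /stuffle_sum big_seq1 series_tree_coef Zst_treeE.
by apply: eq_big_nat => k /andP[k0 _]; rewrite IHs.
Qed.

End Coefficients.

(** * Convergence of the nested sums *)

Section StuffleConvergence.
Variable R : realType.
Implicit Types (s : seq (tree Npos)).

Definition harmonic_sum (N : nat) : R := \sum_(1 <= n < N) n%:R^-1.

Local Notation H := harmonic_sum.

Lemma harmonic_sum_ge0 N : 0 <= H N.
Proof. by apply: sumr_ge0 => n _; rewrite invr_ge0. Qed.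

Lemma harmonic_sumS k : (0 < k)%N -> H k.+1 = H k + k%:R^-1.
Proof. by move=> k0; rewrite /H big_nat_recr. Qed.

Lemma harmonic_sum_le M N : (M <= N)%N -> H M <= H N.
Proof.
by apply: (@nondecreasing_series R (fun n => n%:R^-1) xpredT 1%N) => n _ _; rewrite invr_ge0.
Qed.

(** Replacing every exponent by 1 and every inner sum by its value at the
    outermost index leaves a product of harmonic sums, one per vertex. *)
Lemma stuffle_sum_le_harmonic s :
  exists d, forall N, stuffle_sum R s N <= H N ^+ d.
Proof.
elim/planar_ind: s => [|a s t [d sd] [e te]].
  by exists 0%N => N; rewrite stuffle_sum_nil.
exists (d.+1 + e)%N => N; rewrite stuffle_sum_cons exprD.
rewrite ler_pM ?Zst_tree_ge0 ?stuffle_sum_ge0 // Zst_treeE exprSr mulr_sumr.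
apply: ler_sum_nat => n /andP[n1 nN]; rewrite [leRHS]mulrC ler_pM ?invr_ge0 ?exprn_ge0 //.
- exact: stuffle_sum_ge0.
- rewrite lef_pV2 ?posrE ?exprn_gt0 ?ltr0n //.
  by rewrite -[leLHS]expr1 ler_weXn2l ?ler1n //; exact: (valP a).
- apply: le_trans (sd n) _; apply: lerXn2r; rewrite ?nnegrE ?harmonic_sum_ge0 //.
  by apply: harmonic_sum_le; exact: ltnW.
Qed.

Lemma ler_subrXX (x y : R) d : 0 <= y -> y <= x ->
  x ^+ d - y ^+ d <= d%:R * x ^+ d.-1 * (x - y).
Proof.
move=> y0 yx; have x0 : 0 <= x by exact: le_trans yx.
elim: d => [|d IHd]; first by rewrite !expr0 subrr !mul0r.
have -> : x ^+ d.+1 - y ^+ d.+1 = x ^+ d * (x - y) + y * (x ^+ d - y ^+ d).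
  by rewrite !exprS; ring.
have -> : d.+1%:R * x ^+ d.+1.-1 * (x - y) = x ^+ d * (x - y) + x * (d%:R * x ^+ d.-1 * (x - y)).
  by case: d {IHd} => [|d] /=; [ring | rewrite exprS -(natr1 d.+1); ring].
rewrite lerD2l; apply: (@le_trans _ _ (y * (d%:R * x ^+ d.-1 * (x - y)))).
  by rewrite ler_wpM2l.
by rewrite ler_wpM2r // !mulr_ge0 ?exprn_ge0 ?subr_ge0.
Qed.

(** Abel summation.  The boolean is the boundary term at k = 1, where the
    harmonic sum is empty. *)
Lemma harmonic_pow_sum_by_parts d N :
  \sum_(1 <= k < N.+1) H k ^+ d * (k%:R^-1 - k.+1%:R^-1) + H N.+1 ^+ d / N.+1%:R =
  (d == 0%N)%:R + \sum_(1 <= k < N.+1) (H k.+1 ^+ d - H k ^+ d) / k.+1%:R.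
Proof.
elim: N => [|N IHN].
  by rewrite !big_geq // add0r addr0 {1}/H big_geq // divr1 expr0n.
rewrite !(@big_nat_recr _ _ _ N.+1) //= [in RHS]addrA -IHN; ring.
Qed.

(** Summation by parts with 1/k - 1/(k+1) >= 1/(2 k^2) trades one factor H
    against the increment 1/k, which lowers the power of H by one. *)
Lemma harmonic_pow_sum_step d N :
  \sum_(1 <= k < N.+1) k%:R ^- 2 * H k ^+ d <=
  2 + 4 * d%:R * \sum_(1 <= k < N.+2) k%:R ^- 2 * H k ^+ d.-1.
Proof.
apply: (@le_trans _ _ (2 * (\sum_(1 <= k < N.+1) H k ^+ d * (k%:R^-1 - k.+1%:R^-1)
   + H N.+1 ^+ d / N.+1%:R))).
  rewrite mulrDr ler_wpDr ?mulr_ge0 ?exprn_ge0 ?harmonic_sum_ge0 ?invr_ge0 //.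
  rewrite mulr_sumr; apply: ler_sum_nat => k /andP[k1 _].
  rewrite mulrCA mulrC ler_wpM2l ?exprn_ge0 ?harmonic_sum_ge0 //.
  have k1' : 1 <= k%:R :> R by rewrite ler1n.
  rewrite -(natr1 k); set x := k%:R in k1' *.
  have -> : 2 * (x^-1 - (x + 1)^-1) = x ^- 2 * (2 * x / (x + 1)) by field; lra.
  have x0 : 0 <= x by lra.
  rewrite ler_peMr ?invr_ge0 ?exprn_ge0 // ler_pdivlMr; lra.
rewrite harmonic_pow_sum_by_parts mulrDr; apply: lerD.
  by rewrite ler_piMr ?ler_nat ?lern1 ?leq_b1.
rewrite [in leRHS]big_nat_recl // mulrDr ler_wpDl ?mulr_ge0 ?invr_ge0 ?exprn_ge0 ?harmonic_sum_ge0 //.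
rewrite !mulr_sumr; apply: ler_sum_nat => k /andP[k1 _].
have k1' : 1 <= k%:R :> R by rewrite ler1n.
apply: (@le_trans _ _ (2 * ((d%:R * H k.+1 ^+ d.-1 * (H k.+1 - H k)) / k.+1%:R))).
  rewrite ler_wpM2l // ler_wpM2r ?invr_ge0 //.
  exact: (ler_subrXX d (harmonic_sum_ge0 k) (harmonic_sum_le (leqnSn k))).
have -> : H k.+1 - H k = k%:R^-1 by rewrite harmonic_sumS //; ring.
set y := H _ ^+ _; have y0 : 0 <= y by rewrite exprn_ge0 ?harmonic_sum_ge0.
rewrite -(natr1 k); set x := k%:R in k1' *.
have -> : 2 * (d%:R * y * x^-1 / (x + 1)) = d%:R * y * (2 / x / (x + 1)) by ring.
have -> : 4 * d%:R * ((x + 1) ^- 2 * y) = d%:R * y * (2 / x / (x + 1) * (2 * x / (x + 1))).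
  by field; lra.
have x0 : 0 <= x by lra.
have x10 : 0 <= x + 1 by lra.
rewrite ler_wpM2l ?mulr_ge0 // ler_peMr ?mulr_ge0 ?invr_ge0 //.
rewrite ler_pdivlMr; lra.
Qed.

Lemma harmonic_pow_sum_bounded d :
  exists C : R, forall N, \sum_(1 <= k < N) k%:R ^- 2 * H k ^+ d <= C.
Proof.
suff [C hC] : exists C : R, forall N, \sum_(1 <= k < N.+1) k%:R ^- 2 * H k ^+ d <= C.
  exists C => -[|N] //; by apply: le_trans (hC 0%N); rewrite !big_geq.
elim: d => [|d [C hC]].
  by exists 2 => N; apply: le_trans (harmonic_pow_sum_step _ _) _; rewrite mulr0 mul0r addr0.
exists (2 + 4 * d.+1%:R * C) => N; apply: le_trans (harmonic_pow_sum_step _ _) _.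
by rewrite lerD2l ler_wpM2l.
Qed.

Lemma Zst_tree_nondecreasing u : nondecreasing_seq (Zst_tree R u).
Proof.
case: u => d s.
have -> : Zst_tree R (Node d s) = (fun N => \sum_(1 <= k < N) k%:R ^- val d * stuffle_sum R s k).
  by apply/funext => N; rewrite Zst_treeE.
apply: nondecreasing_series => n _ _.
by rewrite mulr_ge0 ?invr_ge0 ?exprn_ge0 ?stuffle_sum_ge0.
Qed.

Lemma cvg_Zst_tree u : (2 <= val (decor u))%N -> cvgn (Zst_tree R u).
Proof.
move=> u2; apply: nondecreasing_is_cvgn; first exact: Zst_tree_nondecreasing.
case: u u2 => a s /= a2.
have [d sd] := stuffle_sum_le_harmonic s.
have [C hC] := harmonic_pow_sum_bounded d.
exists C => _ [N _ <-]; apply: le_trans (hC N); rewrite Zst_treeE.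
apply: ler_sum_nat => k /andP[k1 _]; rewrite ler_pM ?invr_ge0 ?exprn_ge0 //.
  exact: stuffle_sum_ge0.
by rewrite lef_pV2 ?posrE ?exprn_gt0 ?ltr0n // ler_weXn2l ?ler1n.
Qed.

End StuffleConvergence.

(** * Power series with nonnegative coefficients on [0, 1[ *)

Section PowerSeries.
Variable R : realType.
Implicit Types (a b g f : nat -> R) (z : R).

(** Nonnegative points are enough: all the coefficients considered are
    nonnegative and all the integrals live on ]0, 1[. *)
Definition disc_summable a := forall z, 0 <= z < 1 -> cvgn (pseries a z).

Definition genfun a z : R := limn (pseries a z).

Lemma summable_le a b : (forall k, 0 <= a k <= b k) ->
  disc_summable b -> disc_summable a.
Proof.
move=> ab sb z z01; have /andP[z0 _] := z01.
apply: (series_le_cvg _ _ _ (sb _ z01)) => k /=.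
- by have /andP[a0 _] := ab k; rewrite mulr_ge0 ?exprn_ge0.
- by have /andP[a0 le] := ab k; rewrite mulr_ge0 ?exprn_ge0 // (le_trans a0).
- by have /andP[a0 le] := ab k; rewrite ler_wpM2r ?exprn_ge0.
Qed.

Lemma pseries_le_genfun a z N : (forall k, 0 <= a k) -> disc_summable a -> 0 <= z < 1 ->
  pseries a z N <= genfun a z.
Proof.
move=> a0 sa z01; apply: nondecreasing_cvgn_le (sa _ z01) _.
by apply: nondecreasing_series => n _ _; have /andP[z0 _] := z01; rewrite mulr_ge0 ?exprn_ge0.
Qed.

Lemma genfun_ge0 a z : (forall k, 0 <= a k) -> disc_summable a -> 0 <= z < 1 -> 0 <= genfun a z.
Proof.
move=> a0 sa z01; apply: le_trans (pseries_le_genfun 0%N a0 sa z01).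
by rewrite /pseries /series /= big_geq.
Qed.

Lemma genfun_le_ub a z M : disc_summable a -> 0 <= z < 1 ->
  (forall N, pseries a z N <= M) -> genfun a z <= M.
Proof. by move=> sa z01 aM; apply: limr_le; [exact: sa|exact: nearW]. Qed.

Lemma genfun_le a z w : (forall k, 0 <= a k) -> disc_summable a -> 0 <= z -> z <= w -> w < 1 ->
  genfun a z <= genfun a w.
Proof.
move=> a0 sa z0 zw w1; have z01 : 0 <= z < 1 by rewrite z0 (le_lt_trans zw).
have w01 : 0 <= w < 1 by rewrite w1 (le_trans z0).
apply: genfun_le_ub => // N; apply: le_trans (pseries_le_genfun N a0 sa w01).
apply: ler_sum => k _; rewrite ler_wpM2l // lerXn2r ?nnegrE //.
exact: le_trans zw.
Qed.

Lemma genfun_gt0 a j z : (forall k, 0 <= a k) -> disc_summable a -> 0 < a j -> 0 < z < 1 ->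
  0 < genfun a z.
Proof.
move=> a0 sa aj /andP[z0 z1]; have z01 : 0 <= z < 1 by rewrite ltW.
apply: lt_le_trans (pseries_le_genfun j.+1 a0 sa z01).
apply: (@series_gt0 R (fun k => a k * z ^+ k) j) => //.
  by move=> n; rewrite mulr_ge0 ?exprn_ge0 // ltW.
by rewrite mulr_gt0 ?exprn_gt0.
Qed.

(** A power series without constant term is O(z) at 0; the constant comes from
    z^k = (2 z)^k 2^-k <= 2 z 2^-k for k >= 1. *)
Lemma genfun_le_linear a z : (forall k, 0 <= a k) -> disc_summable a -> a 0%N = 0 ->
  0 <= z <= 2^-1 -> genfun a z <= 2 * z * genfun a 2^-1.
Proof.
move=> a0 sa a00 /andP[z0 z2].
have h01 : 0 <= (2^-1 : R) < 1 by rewrite invr_ge0 ler0n invf_lt1 ?ltr1n.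
have z01 : 0 <= z < 1 by rewrite z0 (le_lt_trans z2) //; case/andP: h01.
apply: genfun_le_ub => // N.
apply: (@le_trans _ _ (2 * z * pseries a 2^-1 N)); last first.
  by rewrite ler_wpM2l ?mulr_ge0 // pseries_le_genfun.
rewrite /pseries /series /= mulr_sumr; apply: ler_sum => -[_|k _].
  by rewrite a00 !mul0r mulr0.
rewrite mulrCA ler_wpM2l //.
have -> : z ^+ k.+1 = (2 * z) ^+ k.+1 * 2^-1 ^+ k.+1.
  by rewrite -exprMn; congr (_ ^+ _); field.
have z20 : 0 <= 2 * z by lra.
have z21 : 2 * z <= 1 by lra.
by rewrite ler_wpM2r ?exprn_ge0 ?invr_ge0 // exprS ler_piMr // exprn_ile1.
Qed.

Lemma cvg_pseries_cauchy a b z : (forall k, 0 <= a k) -> (forall k, 0 <= b k) ->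
  disc_summable a -> disc_summable b -> 0 <= z < 1 ->
  pseries (cauchy a b) z @ \oo --> genfun a z * genfun b z.
Proof.
move=> a0 b0 sa sb z01; have /andP[z0 _] := z01.
have -> : pseries (cauchy a b) z = series (cauchy (fun k => a k * z ^+ k) (fun k => b k * z ^+ k)).
  congr series; apply/funext => n; rewrite /= /cauchy mulr_suml.
  apply: eq_big_nat => i /andP[_ ilen]; rewrite -[in LHS](@subnKC i n) //.
  by rewrite exprD addKn; ring.
by apply: cvg_series_cauchy; [| |exact: sa|exact: sb] => i; rewrite mulr_ge0 ?exprn_ge0.
Qed.

Lemma summable_cauchy a b : (forall k, 0 <= a k) -> (forall k, 0 <= b k) ->
  disc_summable a -> disc_summable b -> disc_summable (cauchy a b).
Proof.
move=> a0 b0 sa sb z z01; apply/cvg_ex; exists (genfun a z * genfun b z).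
exact: cvg_pseries_cauchy.
Qed.

Lemma genfun_cauchy a b z : (forall k, 0 <= a k) -> (forall k, 0 <= b k) ->
  disc_summable a -> disc_summable b -> 0 <= z < 1 ->
  genfun (cauchy a b) z = genfun a z * genfun b z.
Proof. by move=> *; apply: cvg_lim => //; exact: cvg_pseries_cauchy. Qed.

Lemma cvg_pseries_unit_coef z : pseries (@unit_coef R) z @ \oo --> (1 : R).
Proof.
apply: cvg_near_cst; exists 1%N => // -[//|N] _ /=; apply/eqP.
rewrite /pseries /series /= big_nat_recl // big1 => [|i _]; last by rewrite mul0r.
by rewrite addr0 expr0 mulr1.
Qed.

Lemma cvg_pseries_cst1 z : 0 <= z < 1 -> pseries (fun=> 1) z @ \oo --> (1 - z)^-1.
Proof.
move=> /andP[z0 z1]; have := @cvg_geometric_series R 1 z.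
rewrite ger0_norm // mul1r => /(_ z1).
by rewrite /pseries.
Qed.

Lemma cauchy_cst1 a n : cauchy a (fun=> 1) n = series a n.+1.
Proof. by apply: eq_bigr => i _; rewrite mulr1. Qed.

Lemma cvg_pseries_shift a z : disc_summable a -> 0 < z < 1 ->
  pseries (fun k => a k.+1) z @ \oo --> (genfun a z - a 0%N) / z.
Proof.
move=> sa /andP[z0 z1]; have z01 : 0 <= z < 1 by rewrite ltW.
have -> : pseries (fun k => a k.+1) z = (fun N => (pseries a z N.+1 - a 0%N) / z).
  apply/funext => N; rewrite /pseries /series /= big_nat_recl // expr0 mulr1 [_ + _ - _]addrAC subrr add0r.
  rewrite mulr_suml; apply: eq_bigr => i _; rewrite exprS; field.
  by rewrite gt_eqF.
apply: cvgMl; apply: cvgB; last exact: cvg_cst.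
by have := sa _ z01; rewrite -(cvg_shiftS (pseries a z)).
Qed.

(** Compare with the series at some w in ]z, 1[: by Bernoulli the factor k + 1
    is absorbed by (w / z)^(k+1). *)
Lemma summable_diffs a : (forall k, 0 <= a k) -> disc_summable a ->
  disc_summable (pseries_diffs a).
Proof.
move=> a0 sa z /andP[z0 z1].
have [->|zn0] := eqVneq z 0.
  apply/cvg_ex; exists (pseries_diffs a 0%N); apply: cvg_near_cst.
  exists 1%N => // -[//|N] _; apply/eqP.
  rewrite /pseries /series /= big_nat_recl // big1 => [|i _]; last by rewrite expr0n mulr0.
  by rewrite addr0 expr0 mulr1.
have {}z0 : 0 < z by rewrite lt_neqAle eq_sym zn0.
have [w zw w1] : exists2 w, z < w & w < 1 by exists ((z + 1) / 2); lra.
have w0 : 0 < w by exact: lt_trans zw.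
have w01 : 0 < w < 1 by rewrite w0.
have [h h0 hE] : exists2 h, 0 < h & w / z = 1 + h.
  by exists (w / z - 1); [rewrite subr_gt0 ltr_pdivlMr // mul1r|rewrite addrC subrK].
have cw : cvgn (pseries (fun k => a k.+1) w) by apply/cvg_ex; eexists; exact: cvg_pseries_shift.
have cw' : cvgn (series (fun k => (w / z / h) * (a k.+1 * w ^+ k))).
  exact: (@is_cvg_seriesZ R (fun k => a k.+1 * w ^+ k) (w / z / h) cw).
apply: (series_le_cvg _ _ _ cw') => k /=.
- by rewrite !mulr_ge0 ?exprn_ge0 // ltW.
- by rewrite !mulr_ge0 ?exprn_ge0 ?invr_ge0 // ltW.
rewrite /pseries_diffs.
have bern : k.+1%:R * h <= (w / z) ^+ k.+1.
  rewrite hE.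
  elim: {cw cw'} k.+1 => [|m IHm]; first by rewrite mul0r ler01.
  rewrite exprS -natr1 !mulrDl !mul1r addrC.
  suff : h <= h * (1 + h) ^+ m by lra.
  rewrite ler_peMr ?exprn_ege1 //; lra.
have -> : w / z / h * (a k.+1 * w ^+ k) = a k.+1 * ((w / z) ^+ k.+1 * z ^+ k / h).
  by rewrite expr_div_n !exprS; field; rewrite ?expf_neq0 ?gt_eqF.
rewrite -mulrA mulrCA ler_wpM2l // ler_pdivlMr // mulrAC ler_wpM2r ?exprn_ge0 //.
exact: ltW.
Qed.

Lemma genfun_derivable a z : (forall k, 0 <= a k) -> disc_summable a -> 0 <= z < 1 ->
  is_derive z (1 : R) (genfun a) (genfun (pseries_diffs a) z).
Proof.
move=> a0 sa /andP[z0 z1].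
have d0 b : (forall k, 0 <= b k) -> forall k, 0 <= pseries_diffs b k.
  by move=> b0 k; rewrite mulr_ge0.
pose w := (z + 1) / 2.
have zw : z < w by rewrite /w; lra.
have w1 : w < 1 by rewrite /w; lra.
have w0 : 0 <= w by rewrite /w; lra.
have w01 : 0 <= w < 1 by rewrite w0.
have sd := summable_diffs a0 sa; have sdd := summable_diffs (d0 _ a0) sd.
apply: (@pseries_snd_diffs _ a w); [exact: sa|exact: sd|exact: sdd|].
by rewrite !ger0_norm.
Qed.

Lemma genfun_continuous a z : (forall k, 0 <= a k) -> disc_summable a -> 0 <= z < 1 ->
  {for z, continuous (genfun a)}.
Proof.
move=> a0 sa z01; have [d _] := genfun_derivable a0 sa z01.
by apply: differentiable_continuous; exact/derivable1_diffP.
Qed.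

Lemma integral_genfun_diffs f u v : (forall k, 0 <= f k) -> disc_summable f ->
  0 <= u -> u <= v -> v < 1 ->
  \int[lebesgue_measure]_(t in `[u, v]) genfun (pseries_diffs f) t = genfun f v - genfun f u.
Proof.
move=> f0 sf u0; rewrite le_eqVlt => /predU1P[<- _|uv v1].
  by rewrite set_itv1 Rintegral_set1 subrr.
have d0 k : 0 <= pseries_diffs f k by rewrite mulr_ge0.
have sd := summable_diffs f0 sf.
have in01 t : t \in `[u, v] -> 0 <= t < 1.
  by rewrite in_itv /= => /andP[ut tv]; rewrite (le_trans u0 ut) (le_lt_trans tv).
have in01' t : t \in `]u, v[ -> 0 <= t < 1.
  by move=> /subset_itv_oo_cc; exact: in01.
rewrite /Rintegral (@continuous_FTC2 _ _ (genfun f)) //.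
- apply: continuous_in_subspaceT => t /set_mem /in01 t01; exact: genfun_continuous.
- split; first by move=> t /in01' t01; have [] := genfun_derivable f0 sf t01.
    apply: cvg_at_right_filter; apply: genfun_continuous => //; rewrite u0 /=; exact: lt_trans v1.
  apply: cvg_at_left_filter; apply: genfun_continuous => //; rewrite v1 andbT; lra.
- by move=> t /in01' t01; have [_ <-] := genfun_derivable f0 sf t01; rewrite derive1E.
Qed.

End PowerSeries.

(** * Iterated integrals whose lower bound tends to 0 *)

Section IteratedIntegrals.
Variable R : realType.
Implicit Types (a b g f : nat -> R) (A B : R -> R -> R).

(** Positivity of some coefficient makes the sum positive on ]0, 1[, so that the
    multiplicative lower bound of [approximates] is a genuine approximation. *)
Definition admissible a :=
  [/\ forall k, 0 <= a k, disc_summable a & exists k, 0 < a k].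

(** [A eps] stands for an iterated integral from [eps].  The lower bound is
    multiplicative and uniform for d <= t < 1: in this form it passes to products
    with c replaced by c^2, and to integrals by linearity, with no estimate on
    the kernels 1/t and 1/(1-t), which are unbounded near the ends. *)
Definition approximates A a :=
  [/\ forall eps z, 0 < eps -> z < 1 -> {within `[eps, z], continuous (A eps)},
      forall eps t, 0 < eps -> eps <= t < 1 -> 0 <= A eps t <= genfun a t &
      forall c d, 0 <= c < 1 -> 0 < d -> exists2 e, 0 < e &
        forall eps, 0 < eps <= e -> forall t, d <= t < 1 -> c * genfun a t <= A eps t].

Lemma within_continuousM (D : set R) (f g : R -> R) :
  {within D, continuous f} -> {within D, continuous g} ->
  {within D, continuous (fun t => f t * g t)}.
Proof. by move=> cf cg x; apply: cvgM; [exact: cf|exact: cg]. Qed.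

(** Each induction step loses a factor twice; starting from [c1] leaves [c]. *)
Lemma le_square_lt1 c : 0 <= c < 1 ->
  exists2 c1 : R, 0 <= c1 < 1 & c <= c1 * c1.
Proof.
move=> /andP[c0 c1]; exists ((1 + c) / 2); first by apply/andP; split; lra.
have : 0 <= ((1 - c) / 2) * ((1 - c) / 2) by rewrite -expr2 sqr_ge0.
set s := _ * _; have -> : (1 + c) / 2 * ((1 + c) / 2) = c + s by rewrite /s; field.
lra.
Qed.

Lemma admissible_unit : admissible (@unit_coef R).
Proof.
split; [by move=> k; exact: ler0n| |by exists 0%N; exact: ltr01].
by move=> z _; apply/cvg_ex; exists 1; exact: cvg_pseries_unit_coef.
Qed.

Lemma approximates_unit : approximates (fun _ _ => 1) (@unit_coef R).
Proof.
have genfun1 t : genfun (@unit_coef R) t = 1 by apply: cvg_lim => //; exact: cvg_pseries_unit_coef.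
split.
- by move=> eps z _ _; apply: continuous_subspaceT => x; exact: cvg_cst.
- by move=> eps t _ _; rewrite genfun1 ler01 lexx.
- by move=> c d /andP[_ /ltW c1] _; exists 1 => // eps _ t _; rewrite genfun1 mulr1.
Qed.

Lemma admissible_cauchy a b : admissible a -> admissible b -> admissible (cauchy a b).
Proof.
move=> [a0 sa [i ai]] [b0 sb [j bj]]; split.
- by move=> k; exact: cauchy_ge0.
- exact: summable_cauchy.
- by exists (i + j)%N; exact: cauchy_gt0.
Qed.

Lemma approximates_cauchy A B a b : admissible a -> admissible b ->
  approximates A a -> approximates B b ->
  approximates (fun eps t => A eps t * B eps t) (cauchy a b).
Proof.
move=> [a0 sa _] [b0 sb _] [cA bA lA] [cB bB lB]; split.
- by move=> eps z e0 z1; apply: within_continuousM; [exact: cA|exact: cB].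
- move=> eps t e0 /[dup] et /andP[et1 t1].
  have t01 : 0 <= t < 1 by rewrite t1 andbT (le_trans (ltW e0)).
  rewrite genfun_cauchy //.
  have /andP[? ?] := bA _ _ e0 et; have /andP[? ?] := bB _ _ e0 et.
  by rewrite mulr_ge0 // ler_pM.
- move=> c d /le_square_lt1[c1 c11 cc1] d0.
  have c10 : 0 <= c1 by case/andP: c11.
  have [e e0 eA] := lA _ _ c11 d0; have [e' e'0 eB] := lB _ _ c11 d0.
  exists (Num.min e e'); first by rewrite lt_min e0.
  move=> eps /andP[eps0]; rewrite le_min => /andP[le1 le2] t /[dup] dt /andP[dt1 t1].
  have t01 : 0 <= t < 1 by rewrite t1 andbT (le_trans (ltW d0)).
  have Ga := genfun_ge0 a0 sa t01; have Gb := genfun_ge0 b0 sb t01.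
  rewrite genfun_cauchy //; apply: (@le_trans _ _ ((c1 * genfun a t) * (c1 * genfun b t))).
    by rewrite mulrACA ler_wpM2r // mulr_ge0.
  by rewrite ler_pM ?mulr_ge0 //; [apply: eA|apply: eB] => //; rewrite eps0.
Qed.

Lemma sigma_ge0 l (t : R) : 0 < t < 1 -> 0 <= sigma l t.
Proof. by move=> /andP[t0 t1]; case: l; rewrite /= invr_ge0 ?subr_ge0 ltW. Qed.

Lemma sigma_continuous l (eps z : R) : 0 < eps -> z < 1 ->
  {within `[eps, z], continuous (sigma l)}.
Proof.
move=> e0 z1; apply: continuous_in_subspaceT => t /set_mem /=.
rewrite in_itv /= => /andP[et tz].
case: l; rewrite /sigma /=.
  by apply: cvgV; [rewrite gt_eqF // (lt_le_trans e0)|exact: cvg_id].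
apply: cvgV; first by rewrite subr_eq0 gt_eqF // (le_lt_trans tz).
by apply: cvgB; [exact: cvg_cst|exact: cvg_id].
Qed.

Section Integration.
Variables (l : letter) (A : R -> R -> R) (f g : nat -> R).
Hypotheses (adm_f : admissible f) (f00 : f 0%N = 0).
(* The power series of [f] is the primitive of the kernel times that of [g]. *)
Hypothesis f'E : forall z, 0 < z < 1 -> genfun (pseries_diffs f) z = sigma l z * genfun g z.
Hypothesis Ag : approximates A g.

Let mu := @lebesgue_measure R.

Let integrable_integrand eps u v : 0 < eps -> eps <= u -> v < 1 ->
  mu.-integrable `[u, v] (EFin \o (fun t => sigma l t * A eps t)).
Proof.
move=> e0 eu v1; have [cA _ _] := Ag.
have int_eps : mu.-integrable `[eps, v] (EFin \o (fun t => sigma l t * A eps t)).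
  apply: continuous_compact_integrable; first exact: segment_compact.
  by apply: within_continuousM; [exact: sigma_continuous|exact: cA].
apply: integrableS int_eps => //.
by apply: subset_itvr; rewrite bnd_simp.
Qed.

Let integrable_bound u v : 0 < u -> v < 1 ->
  mu.-integrable `[u, v] (EFin \o genfun (pseries_diffs f)).
Proof.
move=> u0 v1; have [f0 sf _] := adm_f.
apply: continuous_compact_integrable; first exact: segment_compact.
apply: continuous_in_subspaceT => t /set_mem /=; rewrite in_itv /= => /andP[ut tv].
apply: genfun_continuous; [by move=> k; rewrite mulr_ge0|exact: summable_diffs|].
by rewrite (le_trans (ltW u0)) // (le_lt_trans tv).
Qed.

(** From above, integrate the upper bound on [A].  From below, discard the
    integral up to some small [d2]: on the rest [A] is at least [c1] times the
    power series of [g], whence [c1 * (f t - f d2)], and [f d2] is at most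
    [(1 - c1) * f d] because the series of [f] vanishes at 0. *)
Lemma approximates_integral :
  approximates (fun eps z => \int[mu]_(t in `[eps, z]) (sigma l t * A eps t)) f.
Proof.
have [f0 sf [j fj]] := adm_f; have [cA bA lA] := Ag.
have f'0 eps t : 0 < eps -> eps <= t < 1 -> 0 <= sigma l t * A eps t.
  move=> e0 /[dup] et /andP[et1 t1].
  by rewrite mulr_ge0 ?sigma_ge0 ?(lt_le_trans e0) //; case/andP: (bA _ _ e0 et).
split.
- move=> eps z e0 z1; have [ez|ze] := leP eps z.
    by apply: (parameterized_integral_continuous ez); exact: integrable_integrand.
  by rewrite set_itv_ge ?bnd_simp -?ltNge //; exact: continuous_subspace0.
- move=> eps t e0 /andP[et t1]; apply/andP; split.
    apply: Rintegral_ge0 => x /=; rewrite in_itv /= => /andP[ex xt].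
    by apply: f'0 => //; rewrite ex (le_lt_trans xt).
  apply: (@le_trans _ _ (genfun f t - genfun f eps)); last first.
    by rewrite gerBl genfun_ge0 // ltW //= (le_lt_trans et).
  rewrite -(integral_genfun_diffs f0 sf (ltW e0) et t1).
  apply: le_Rintegral => //; [exact: integrable_integrand|exact: integrable_bound|].
  move=> x /=; rewrite in_itv /= => /andP[ex xt].
  have x01 : 0 < x < 1 by rewrite (lt_le_trans e0) // (le_lt_trans xt).
  rewrite f'E // ler_wpM2l ?sigma_ge0 //.
  have ex1 : eps <= x < 1 by rewrite ex (le_lt_trans xt).
  by case/andP: (bA _ _ e0 ex1).
- move=> c d /le_square_lt1[c1 /[dup] c11 /andP[c10 c1_1] cc1] d0.
  have [d1|d1] := leP 1 d.
    by exists 1 => // eps _ t /andP[dt /(le_lt_trans dt)]; rewrite ltNge d1.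
  have h01 : 0 < (2^-1 : R) < 1 by rewrite invr_gt0 ltr0n invf_lt1 ?ltr1n.
  have d01 : 0 < d < 1 by rewrite d0.
  have fd := genfun_gt0 f0 sf fj d01; have fh := genfun_gt0 f0 sf fj h01.
  have [d2 d20 [d2d d2h d2f]] : exists2 d2, 0 < d2 &
      [/\ d2 <= d, d2 <= 2^-1 & genfun f d2 <= (1 - c1) * genfun f d].
    (* The value at which the bound 2 z f(1/2) equals (1 - c1) f(d). *)
    pose q := (1 - c1) * genfun f d / (2 * genfun f 2^-1).
    have q0 : 0 < q by rewrite divr_gt0 ?mulr_gt0 // subr_gt0.
    pose d2 := Num.min q (Num.min d 2^-1).
    have d20 : 0 < d2 by rewrite !lt_min q0 d0 /=; case/andP: h01.
    have d2h : d2 <= 2^-1 by rewrite !ge_min lexx !orbT.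
    exists d2 => //; split => //; first by rewrite !ge_min lexx !orbT.
    apply: le_trans (genfun_le_linear f0 sf f00 _) _; first by rewrite ltW.
    rewrite mulrAC mulrC -ler_pdivlMr ?mulr_gt0 // -/q.
    by rewrite ge_min lexx.
  have [e e0 eA] := lA _ _ c11 d20.
  exists (Num.min e d2); first by rewrite lt_min e0.
  move=> eps /andP[eps0]; rewrite le_min => /andP[epse epsd] t /andP[dt t1].
  have d2t : d2 <= t by exact: le_trans dt.
  have t01 : 0 <= t < 1 by rewrite t1 (le_trans (ltW d20)).
  apply: (@le_trans _ _ (\int[mu]_(x in `[d2, t]) (sigma l x * A eps x))); last first.
    have int_eps : mu.-integrable `[eps, t] (EFin \o (fun x => sigma l x * A eps x)).
      exact: integrable_integrand.
    rewrite -(Rintegral_itv_obnd_cbnd (r := d2)); last first.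
      apply: integrableS int_eps => //.
      by apply: subset_itvr; rewrite bnd_simp.
    rewrite -(Rintegral_itvB int_eps) ?bnd_simp // gerBl.
    apply: Rintegral_ge0 => x /=; rewrite in_itv /= => /andP[ex xd].
    by apply: f'0 => //; rewrite ex (le_lt_trans xd) // (le_lt_trans d2t).
  apply: (@le_trans _ _ (\int[mu]_(x in `[d2, t]) (c1 * genfun (pseries_diffs f) x))).
    rewrite RintegralZl //; last exact: integrable_bound.
    rewrite (integral_genfun_diffs f0 sf (ltW d20) d2t t1).
    have fdt : genfun f d <= genfun f t by apply: genfun_le => //; exact: ltW.
    apply: (@le_trans _ _ (c1 * (c1 * genfun f t))).
      by rewrite mulrA ler_wpM2r // genfun_ge0.
    rewrite ler_wpM2l // lerBrDr.
    apply: (@le_trans _ _ (c1 * genfun f t + (1 - c1) * genfun f t)); last first.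
      by rewrite -mulrDl subrKC mul1r.
    rewrite lerD2l; apply: le_trans d2f _.
    by rewrite ler_wpM2l // subr_ge0 ltW.
  apply: le_Rintegral => //.
  + have := integrable_bound d20 t1; exact: integrableZl.
  + exact: integrable_integrand.
  move=> x /=; rewrite in_itv /= => /andP[dx xt].
  have x01 : 0 < x < 1 by rewrite (lt_le_trans d20) // (le_lt_trans xt).
  rewrite f'E // mulrCA ler_wpM2l ?sigma_ge0 //.
  by apply: eA; [rewrite eps0|rewrite dx; case/andP: x01].
Qed.

End Integration.

End IteratedIntegrals.

(** * Generating functions of binarised forests *)

Section Binarisation.
Variable R : realType.
Implicit Types (a g : nat -> R) (s : seq (tree Npos)).

Lemma node_coef0 d g : node_coef d g 0%N = 0.
Proof. by rewrite /node_coef /series /= big_geq // mulr0. Qed.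

Lemma node_coefS d g k : node_coef d.+1 g k = k%:R^-1 * node_coef d g k.
Proof. by rewrite /node_coef exprS invfM mulrA. Qed.

Lemma node_coef_gt0 d g j k : (forall i, 0 <= g i) -> 0 < g j -> (j < k)%N ->
  0 < node_coef d g k.
Proof.
move=> g0 gj jk; rewrite mulr_gt0 ?(series_gt0 g0 gj) // invr_gt0 exprn_gt0 // ltr0n.
exact: leq_trans jk.
Qed.

(** The right-hand side is the Cauchy product of [g] with constant
    coefficients, which gives summability of [node_coef d g]. *)
Lemma node_coef_le d g k : (forall i, 0 <= g i) -> node_coef d g k <= series g k.+1.
Proof.
move=> g0; case: k => [|k]; first by rewrite node_coef0 series_ge0.
apply: (@le_trans _ _ (series g k.+1)); last exact: series_le.
by rewrite ler_piMl ?series_ge0 // invf_le1 ?exprn_gt0 ?ltr0n // exprn_ege1 // ler1n.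
Qed.

Lemma admissible_node d g : admissible g -> admissible (node_coef d g).
Proof.
move=> [g0 sg [j gj]]; split; first by move=> k; exact: node_coef_ge0.
- apply: (@summable_le _ _ (cauchy g (fun=> 1))).
    by move=> k; rewrite cauchy_cst1 node_coef_ge0 //= node_coef_le.
  apply: summable_cauchy => // z z01; apply/cvg_ex; eexists; exact: cvg_pseries_cst1.
- by exists j.+1; exact: node_coef_gt0 gj _.
Qed.

(** The kernel 1/(1-t) is the power series with constant coefficients, and the
    Cauchy product with it takes partial sums. *)
Lemma genfun_diffs_node1 g z : admissible g -> 0 < z < 1 ->
  genfun (pseries_diffs (node_coef 1 g)) z = sigma Ly z * genfun g z.
Proof.
move=> [g0 sg _] /andP[z0 z1]; have z01 : 0 <= z < 1 by rewrite ltW.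
have -> : pseries_diffs (node_coef 1 g) = cauchy g (fun=> 1).
  apply/funext => k; rewrite cauchy_cst1 /pseries_diffs /node_coef expr1.
  by rewrite mulrA mulfV ?mul1r // pnatr_eq0.
have c1 : disc_summable (fun=> 1 : R).
  by move=> w w01; apply/cvg_ex; eexists; exact: cvg_pseries_cst1.
rewrite genfun_cauchy // mulrC; congr (_ * _).
by apply: cvg_lim => //; exact: cvg_pseries_cst1.
Qed.

(** The division by z is a shift of coefficients because [node_coef d g]
    vanishes at 0. *)
Lemma genfun_diffs_nodeS d g z : admissible g -> 0 < z < 1 ->
  genfun (pseries_diffs (node_coef d.+1 g)) z = sigma Lx z * genfun (node_coef d g) z.
Proof.
move=> ag z01; have [_ sn _] := admissible_node d ag.
have -> : pseries_diffs (node_coef d.+1 g) = (fun k => node_coef d g k.+1).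
  apply/funext => k; rewrite /pseries_diffs node_coefS.
  by rewrite mulrA mulfV ?mul1r // pnatr_eq0.
apply: cvg_lim => //; have := cvg_pseries_shift sn z01.
by rewrite node_coef0 subr0 mulrC.
Qed.

Definition shuffle_prod s (eps z : R) : R := \prod_(u <- map bin_tree s) Ash_tree eps u z.

Lemma Ash_treeE eps l (ss : seq (tree letter)) z :
  Ash_tree eps (Node l ss) z =
  \int[lebesgue_measure]_(t in `[eps, z]) (sigma l t * \prod_(u <- ss) Ash_tree (R := R) eps u t).
Proof. by apply: eq_Rintegral => t _; rewrite big_map. Qed.

(** One integration against dt/(1-t) for the vertex y, then n integrations
    against dt/t for the vertices x above it. *)
Lemma approximates_bin_tree n g (ss : seq (tree letter)) : admissible g ->
  approximates (fun eps z => \prod_(u <- ss) Ash_tree eps u z) g ->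
  approximates (fun eps z => Ash_tree eps (iter n (fun t => Node Lx [:: t]) (Node Ly ss)) z)
    (node_coef n.+1 g).
Proof.
move=> ag Ag; elim: n => [|n IHn].
  have := approximates_integral (admissible_node 1 ag) (node_coef0 1 g)
    (fun z => @genfun_diffs_node1 g z ag) Ag.
  congr approximates; apply/funext => eps; apply/funext => z /=.
  by rewrite Ash_treeE.
have := approximates_integral (admissible_node n.+2 ag)
  (node_coef0 n.+2 g) (fun z => @genfun_diffs_nodeS n.+1 g z ag) IHn.
congr approximates; apply/funext => eps; apply/funext => z.
by rewrite iterS Ash_treeE; apply: eq_Rintegral => t _; rewrite big_seq1.
Qed.

Lemma approximates_forest s :
  admissible (forest_coef R s) /\ approximates (shuffle_prod s) (forest_coef R s).
Proof.
elim/planar_ind: s => [|d s t [as_ As] [at_ At]].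
  split; first exact: admissible_unit.
  have := approximates_unit R; congr approximates.
  by apply/funext => eps; apply/funext => z; rewrite /shuffle_prod big_nil.
split; first by apply: admissible_cauchy => //; exact: admissible_node.
have := @approximates_bin_tree (val d).-1 _ _ as_ As.
rewrite prednK ?(valP d) // => Ad.
have := approximates_cauchy (admissible_node (val d) as_) at_ Ad At.
congr approximates; apply/funext => eps; apply/funext => z.
by rewrite /shuffle_prod big_cons -bin_treeE.
Qed.

(** The lower bound at [c] is within [e] of the limit once (1 - c) times the
    limit is at most [e]. *)
Lemma approximates_cvg (A : R -> R -> R) a t : admissible a -> approximates A a ->
  0 < t < 1 -> A eps t @[eps --> 0^'+] --> genfun a t.
Proof.
move=> [a0 sa _] [_ bA lA] /andP[t0 t1].
have M0 : 0 <= genfun a t by rewrite genfun_ge0 // ltW.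
apply/cvgrPdist_le => e e0.
pose c := 1 - e / (genfun a t + 1 + e).
have D0 : 0 < genfun a t + 1 + e by lra.
have c01 : 0 <= c < 1.
  apply/andP; split; last by rewrite /c gtrBl divr_gt0.
  rewrite /c subr_ge0 ler_pdivrMr // mul1r; lra.
have [e' e'0 eA] := lA _ _ c01 t0.
near=> eps.
have eps0 : 0 < eps by near: eps; exact: nbhs_right_gt.
have et : eps <= t by near: eps; exact: nbhs_right_le.
have ee : eps <= e' by near: eps; exact: nbhs_right_le.
have /andP[_ up] := bA eps t eps0 (introT andP (conj et t1)).
rewrite ger0_norm ?subr_ge0 //.
have := eA eps (introT andP (conj eps0 ee)) t (introT andP (conj (lexx t) t1)).
have : e / (genfun a t + 1 + e) * genfun a t <= e.
  rewrite mulrAC ler_pdivrMr // ler_wpM2l ?ltW //; lra.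
rewrite /c mulrBl mul1r; lra.
Unshelve. all: by end_near. Qed.

(** Abel's theorem for nonnegative coefficients: the sum at z < 1 is at most L,
    and at least a partial sum, which is continuous at z = 1. *)
Lemma abel_cvg a (L : R) : (forall k, 0 <= a k) -> disc_summable a ->
  series a @ \oo --> L -> genfun a z @[z --> 1^'-] --> L.
Proof.
move=> a0 sa aL.
have leL N : series a N <= L.
  rewrite -(cvg_lim _ aL) //; apply: nondecreasing_cvgn_le; last by apply/cvg_ex; exists L.
  by apply: nondecreasing_series.
apply/cvgrPdist_le => e e0.
have [N PN] : exists N, L - e / 2 <= series a N.
  have /cvgrPdist_le/(_ (e / 2) (divr_gt0 e0 (ltr0Sn R 1)))[N _ hN] := aL.
  exists N; have := hN N (leqnn N); rewrite /= ger0_norm ?subr_ge0 //; lra.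
have cN : pseries a z N @[z --> 1^'-] --> series a N.
  have -> : series a N = pseries a 1 N.
    by apply: eq_bigr => k _; rewrite /= expr1n mulr1.
  apply: cvg_at_left_filter.
  rewrite /pseries /series /=; apply: cvg_big => [|k _]; first exact: add_continuous.
  by apply: cvgMr; exact: exprn_continuous.
have /cvgrPdist_le/(_ (e / 2) (divr_gt0 e0 (ltr0Sn R 1))) near1 := cN.
near=> z.
have z0 : 0 < z by near: z; apply: nbhs_left_gt; exact: ltr01.
have z1 : z < 1 by near: z; exact: nbhs_left_lt.
have z01 : 0 <= z < 1 by rewrite ltW.
have : `|series a N - pseries a z N| <= e / 2 by near: z.
have gL : genfun a z <= L.
  apply: genfun_le_ub => // M; apply: le_trans (leL M).
  by apply: ler_sum => k _; rewrite ler_piMr // exprn_ile1 // ltW.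
have := pseries_le_genfun N a0 sa z01.
rewrite (@ger0_norm _ (L - _)) ?subr_ge0 // => h1 /(le_trans (ler_norm _)) h2; lra.
Unshelve. all: by end_near. Qed.

End Binarisation.

(** * Comparison of the two zeta values *)

Section Comparison.
Variable R : realType.
Implicit Types (u : tree Npos) (s : seq (tree Npos)).

Definition tree_sh u : R := limn (series (tree_coef R u)).
Definition tree_st u : R := limn (Zst_tree R u).

Lemma cvg_series_tree_coef u : (2 <= val (decor u))%N -> cvgn (series (tree_coef R u)).
Proof.
move=> u2; apply: nondecreasing_is_cvgn.
  by apply: nondecreasing_series => k _ _; exact: tree_coef_ge0.
exists (tree_st u) => _ [N _ <-]; apply: le_trans (series_tree_coef_le R u N) _.
by apply: nondecreasing_cvgn_le; [exact: Zst_tree_nondecreasing|exact: cvg_Zst_tree].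
Qed.

Lemma tree_sh_ge0 u : (2 <= val (decor u))%N -> 0 <= tree_sh u.
Proof.
move=> u2; apply: limr_ge; first exact: cvg_series_tree_coef.
by apply: nearW => N; apply: series_ge0 => k; exact: tree_coef_ge0.
Qed.

Lemma tree_st_gt0 u : (2 <= val (decor u))%N -> 0 < tree_st u.
Proof.
move=> u2; have [j uj] := forest_coef_neq0 R [:: u].
rewrite forest_coef1 in uj.
apply: (@lt_le_trans _ _ (Zst_tree R u j.+1)).
  apply: lt_le_trans (series_tree_coef_le R u _).
  by apply: series_gt0 uj _ => // k; exact: tree_coef_ge0.
by apply: nondecreasing_cvgn_le; [exact: Zst_tree_nondecreasing|exact: cvg_Zst_tree].
Qed.

(** The gap at N is a sum over k < N of gaps of the forest below the root, so a
    gap present at some N survives in the limit. *)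
Lemma tree_gap_nondecreasing u :
  nondecreasing_seq (fun N => Zst_tree R u N - series (tree_coef R u) N).
Proof.
case: u => d s.
have -> : (fun N => Zst_tree R (Node d s) N - series (tree_coef R (Node d s)) N) =
    (fun N => \sum_(1 <= k < N) k%:R ^- val d * (stuffle_sum R s k - series (forest_coef R s) k)).
  apply/funext => N; rewrite Zst_treeE series_tree_coef -sumrB.
  by apply: eq_bigr => k _; rewrite mulrBr.
apply: nondecreasing_series => k _ _.
by rewrite mulr_ge0 ?invr_ge0 ?exprn_ge0 // subr_ge0 series_forest_coef_le.
Qed.

Lemma tree_sh_leif u : (2 <= val (decor u))%N ->
  tree_sh u <= tree_st u ?= iff ~~ branched [:: u].
Proof.
move=> u2; have cP := cvg_series_tree_coef u2; have cZ := @cvg_Zst_tree R u u2.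
split; first by apply: ler_lim => //; apply: nearW => N; exact: series_tree_coef_le.
have [bu|nbu] := boolP (branched [:: u]); last first.
  apply/eqP; rewrite /tree_sh /tree_st.
  suff -> : series (tree_coef R u) = Zst_tree R u by [].
  apply/funext => -[|N].
    by case: u {u2 cP cZ nbu} => d s; rewrite Zst_treeE series_tree_coef !big_geq.
  rewrite -forest_coef1 series_forest_coef_eq //.
  by rewrite /stuffle_sum big_seq1.
have [K _ hK] := @series_forest_coef_lt R [:: u] bu.
have := hK K (leqnn K); rewrite /= forest_coef1 /stuffle_sum big_seq1 => lt.
apply: lt_eqF; rewrite -subr_gt0 /tree_st /tree_sh -limB //.
have cD : cvgn (fun N => Zst_tree R u N - series (tree_coef R u) N) by exact: is_cvgB.
apply: lt_le_trans (nondecreasing_cvgn_le (@tree_gap_nondecreasing u) cD K).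
by rewrite subr_gt0.
Qed.

Lemma branched_cons u s : branched (u :: s) = branched [:: u] || branched s.
Proof. by rewrite /branched /= cats0 has_cat. Qed.

Lemma prod_tree_sh_leif s : all (fun u => 2 <= val (decor u))%N s ->
  \prod_(u <- s) tree_sh u <= \prod_(u <- s) tree_st u ?= iff ~~ branched s.
Proof.
elim: s => [_|u s IHs /= /andP[u2 s2]]; first by rewrite !big_nil; split; rewrite ?eqxx.
rewrite !big_cons branched_cons negb_or.
have sh0 : 0 <= \prod_(v <- s) tree_sh v.
  by rewrite big_seq; apply: prodr_ge0 => v vs; apply: tree_sh_ge0; exact: (allP s2).
have st0 : 0 < \prod_(v <- s) tree_st v.
  by rewrite big_seq; apply: prodr_gt0 => v vs; apply: tree_st_gt0; exact: (allP s2).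
have := leif_pM (tree_sh_ge0 u2) sh0 (tree_sh_leif u2) (IHs s2).
by rewrite gt_eqF ?mulr_gt0 ?tree_st_gt0.
Qed.

Lemma cvg_series_forest_coef s : all (fun u => 2 <= val (decor u))%N s ->
  series (forest_coef R s) @ \oo --> \prod_(u <- s) tree_sh u.
Proof.
elim: s => [_|u s IHs /= /andP[u2 s2]].
  rewrite big_nil; apply: cvg_near_cst; exists 1%N => // -[//|N] _; apply/eqP.
  by rewrite series_unit_coef.
rewrite big_cons; apply: cvg_series_cauchy.
- by move=> k; exact: tree_coef_ge0.
- by move=> k; exact: forest_coef_ge0.
- exact: cvg_series_tree_coef.
- exact: IHs.
Qed.

Lemma zeta_shE (F : forest Npos) : st_convergent F ->
  zeta_sh R (sT F) = \prod_(u <- repr F) tree_sh u.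
Proof.
move=> hF; have [adm app] := approximates_forest R (repr F).
apply: cvg_lim => //.
have [a0 sa _] := adm.
have := abel_cvg a0 sa (cvg_series_forest_coef hF).
apply: cvg_trans; apply: near_eq_cvg; near=> z.
have z01 : 0 < z < 1.
  apply/andP; split; near: z; [apply: nbhs_left_gt; exact: ltr01|exact: nbhs_left_lt].
symmetry; apply: cvg_lim => //.
have -> : (fun eps => Ash eps (sT F) z) = (fun eps => shuffle_prod (repr F) eps z).
  by apply/funext => eps; rewrite /Ash (Ash_fiso _ _ (fiso_repr_pi _)).
exact: approximates_cvg.
Unshelve. all: by end_near. Qed.

Lemma zeta_stE (F : forest Npos) : st_convergent F ->
  zeta_st R F = \prod_(u <- repr F) tree_st u.
Proof.
move=> hF; apply: cvg_lim => //; rewrite /Zst.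
move: hF; rewrite /st_convergent; elim: (repr F) => [_|u s IHs /= /andP[u2 s2]].
  by under eq_fun do rewrite big_nil; rewrite big_nil; exact: cvg_cst.
under eq_fun do rewrite big_cons; rewrite big_cons.
by apply: cvgM; [exact: cvg_Zst_tree|exact: IHs].
Qed.

End Comparison.

Unset Implicit Arguments.

Theorem theorem5 (R : realType) (F : forest Npos) (hF : st_convergent F) :
  zeta_sh R (sT F) <= zeta_st R F
  /\ (zeta_sh R (sT F) = zeta_st R F <-> no_branching F).
Proof.
have [le eqE] := prod_tree_sh_leif R hF.
rewrite zeta_shE // zeta_stE //; split=> //.
by rewrite /no_branching /fvertices -/(branched (repr F)) -eqE; split=> [->|/eqP].
Qed.
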